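(* Let $E$ be an election domain on a finite set of voters $V$ (with candidate set $C=\{c_1,c_2,c_3\}$) which contains a ballot domain. If a SWF $F$ on $E$ fulfils condition TA and is weakly Borda with respect to a Borda rule $B_w$, then $F$ is weakly Borda with respect to an unweighted Borda rule $B$.
   Context: $V$ is a finite set of voters, $C=\{c_1,c_2,c_3\}$ is the set of candidates. A ballot is a bijection $r:C\to\{0,1,2\}$ (larger value means ranked higher); $\mathfrak{R}$ is the set of all ballots. An election domain is a subset $E\subset\mathfrak{R}^V$; its elements are elections $e$, with $e(v)$ the ballot of $v$. A ballot domain is an election domain of the form $\mathfrak{B}^V$ with $\mathfrak{B}\subset\mathfrak{R}$ and $|\mathfrak{B}|\ge2$. An election result $\succ$ is a weak ordering of $C$ (ties allowed). A SWF is a function $F$ from $E$ to the set of weak orderings of $C$. For a result $\succ$, $\pi_{i,j}(\succ)=W$ if $c_i\succ c_j$, $L$ if $c_j\succ c_i$, and $T$ if they are tied. TA (transitive anonymity): there is a group $G$ acting transitively on $V$ such that the induced action $g(e)(v)=e(g(v))$ maps $E$ to $E$ and $F(g(e))=F(e)$ for all $g\in G$, $e\in E$. Borda rules: for weights $w=(w_v)_{v\in V}\in\mathbb{R}^V$, the Borda rule $B_w$ is the SWF ranking candidates by the score $b_w(c_i,e)=\sum_{v\in V}e(v)(c_i)\,w_v$ (higher score wins, equal scores tie). It is unweighted if $w$ is constant on $V$. A SWF $F$ is weakly Borda with respect to $B_w$ if $w\not\equiv0$ and for all $e\in E$ and all $i\neq j$, $\pi_{i,j}(B_w(e))\ne T$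 implies $\pi_{i,j}(F(e))=\pi_{i,j}(B_w(e))$. (In particular, being weakly Borda with respect to an unweighted rule refers to a nonzero constant weight.) *)

(* Defs.v *)
From HB Require Import structures.
From mathcomp Require Import all_boot all_order all_algebra all_fingroup.
From mathcomp Require Import reals.

Set Implicit Arguments.
Unset Strict Implicit.
Unset Printing Implicit Defensive.

Import Order.TTheory GRing.Theory Num.Theory.
Local Open Scope ring_scope.

(* The candidates c_1, c_2, c_3 are the elements of 'I_3. *)
Definition candidate : finType := 'I_3.

(* A ballot is a bijection from the candidates to the ranks {0, 1, 2}; both
   sides are 'I_3, hence permutations.  A larger value means ranked higher. *)
Definition ballot : finType := {perm 'I_3}.

Definition election (V : finType) : finType := {ffun V -> ballot}.

Definition ballot_domain (V : finType) (B : {set ballot}) : {set election V} :=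
  [set e : election V | [forall v, e v \in B]].

Definition contains_ballot_domain (V : finType) (E : {set election V}) : Prop :=
  exists2 B : {set ballot}, (2 <= #|B|)%N & ballot_domain V B \subset E.

(* Weak orderings are given by their strict part: (c, d) is in the relation
   when c is strictly preferred to d, and c, d are tied when neither (c, d) nor
   (d, c) is.  Finite sets of pairs are used instead of relations so that
   Leibniz equality of results is extensional. *)
Definition is_weak_order (P : {set candidate * candidate}) : bool :=
  [forall c, forall d, ((c, d) \in P) ==> ((d, c) \notin P)] &&
  [forall c, forall d, forall x,
     ((c, d) \in P) ==> (((c, x) \in P) || ((x, d) \in P))].

Definition weak_order : Type := {P : {set candidate * candidate} | is_weak_order P}.

Definition prefers (s : weak_order) (c d : candidate) : bool := (c, d) \in val s.

Inductive outcome : Type := Win | Lose | Tie.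

Definition pairwise (i j : candidate) (s : weak_order) : outcome :=
  if prefers s i j then Win else if prefers s j i then Lose else Tie.

Definition SWF (V : finType) (E : {set election V}) : Type :=
  {e : election V | e \in E} -> weak_order.

(* g(e)(v) = e(g(v)), for a permutation or any other self-map g of V. *)
Definition induced (V : finType) (g : V -> V) (e : election V) : election V :=
  [ffun v => e (g v)].

(* The group is arbitrary, possibly infinite and acting non-faithfully; the
   actions of the finite group library require a finite group. *)
Definition is_group_action (G : groupType) (V : Type) (act : G -> V -> V) : Prop :=
  (forall v, act 1%g v = v) /\
  (forall g h v, act (g * h)%g v = act g (act h v)).

Definition is_transitive (G : groupType) (V : Type) (act : G -> V -> V) : Prop :=
  forall u v, exists g, act g u = v.

Definition TA (V : finType) (E : {set election V}) (F : SWF E) : Prop :=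
  exists (G : groupType) (act : G -> V -> V),
    [/\ is_group_action act,
        is_transitive act,
        forall g e, e \in E -> induced (act g) e \in E
      & forall g (e e' : {e : election V | e \in E}),
          val e' = induced (act g) (val e) -> F e' = F e].

Definition borda_score (R : realType) (V : finType) (w : V -> R)
    (c : candidate) (e : election V) : R :=
  \sum_(v : V) (e v c)%:R * w v.

Definition borda_rel (R : realType) (V : finType) (w : V -> R)
    (e : election V) : {set candidate * candidate} :=
  [set p | borda_score w p.2 e < borda_score w p.1 e].

Lemma borda_relP (R : realType) (V : finType) (w : V -> R) (e : election V) :
  is_weak_order (borda_rel w e).
Proof.
apply/andP; split.
  apply/forallP => c; apply/forallP => d; apply/implyP.
  by rewrite !inE /= => /ltW; rewrite leNgt.
apply/forallP => c; apply/forallP => d; apply/forallP => x; apply/implyP.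
rewrite !inE /= => dc.
by case: (ltP (borda_score w x e) (borda_score w c e)) => //= /(lt_le_trans dc).
Qed.

Definition borda (R : realType) (V : finType) (w : V -> R)
    (E : {set election V}) : SWF E :=
  fun e => Sub (borda_rel w (val e)) (borda_relP w (val e)).

Definition unweighted (R : realType) (V : finType) (w : V -> R) : Prop :=
  exists a : R, forall v, w v = a.

Definition weakly_borda (R : realType) (V : finType) (E : {set election V})
    (F : SWF E) (w : V -> R) : Prop :=
  (exists v, w v != 0) /\
  (forall (e : {e : election V | e \in E}) (i j : candidate), i != j ->
     pairwise i j (borda w e) <> Tie ->
     pairwise i j (F e) = pairwise i j (borda w e)).

(* Main.v *)
Require Import Defs.
From mathcomp Require Import all_boot all_order all_algebra all_fingroup.
From mathcomp Require Import boolp reals.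

(** The weak Borda condition for [w] is inherited by the sum of the translates
  of [w] under the finitely many permutations induced by the group: a positive
  score difference for the sum is positive for some translate.  By transitivity
  the sum is constant, and it is nonzero unless the weights [w] add up to zero.
  In that case, take two ballots [b], [b'] of the ballot domain and candidates
  [i], [j] with [b i < b' i] and [b' j < b j].  When one voter [u] casts [b] and
  all others [b'], the score difference of [j] and [i] is [w u] times a positive
  constant, so it takes both signs as [u] varies, whereas the result of [F] does
  not depend on [u]. *)

Set Implicit Arguments.
Unset Strict Implicit.
Unset Printing Implicit Defensive.

Import Order.TTheory GRing.Theory Num.Theory.
Local Open Scope ring_scope.

Lemma prefers_asym (s : weak_order) c d : prefers s c d -> ~~ prefers s d c.
Proof.
by rewrite /prefers; case/andP: (valP s) => /forallP/(_ c)/forallP/(_ d)/implyP.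
Qed.

Lemma prefers_borda (R : realType) (V : finType) (E : {set election V})
    (w : V -> R) (e : {e : election V | e \in E}) i j :
  prefers (borda w e) i j = (borda_score w j (val e) < borda_score w i (val e)).
Proof. by rewrite /prefers inE. Qed.

(** Strict preferences suffice: a [Lose] outcome is a [Win] with [i] and [j] exchanged, and a strict
    inequality of scores already forces [i != j]. *)
Lemma weakly_bordaP (R : realType) (V : finType) (E : {set election V})
    (F : SWF E) (w : V -> R) :
  weakly_borda F w <->
  (exists v, w v != 0) /\
  (forall (e : {e : election V | e \in E}) i j,
     borda_score w j (val e) < borda_score w i (val e) -> prefers (F e) i j).
Proof.
split=> -[w0 wF]; split=> // e i j.
  move=> lt_ji; have ij : i != j by apply: contraTneq lt_ji => ->; rewrite ltxx.
  have := wF e i j ij; rewrite /Defs.pairwise (prefers_borda w) lt_ji.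
  case: (prefers (F e) i j) => // WF.
  by suff /WF : Win <> Tie by case: (prefers (F e) j i).
move=> _; rewrite /Defs.pairwise !prefers_borda.
case: ifP => [/wF -> //|_]; case: ifP => // /wF Fji _.
by rewrite Fji (negbTE (prefers_asym Fji)).
Qed.

Lemma group_action_inj (G : groupType) (V : Type) (act : G -> V -> V) g :
  is_group_action act -> injective (act g).
Proof.
move=> [act1 actM]; apply: (can_inj (g := act g^-1%g)) => v.
by rewrite -actM mulVg act1.
Qed.

Lemma transitive_sum_const (R : realType) (V : finType) (G : groupType)
    (act : G -> V -> V) (w : V -> R) :
  is_group_action act -> is_transitive act ->
  exists (H : {set {perm V}}) (a : R),
    [/\ forall p : {perm V}, p \in H -> exists g, p =1 act g,
        forall v, \sum_(p in H) w (p v) = a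
      & \sum_v w v != 0 -> a != 0].
Proof.
move=> actG tr; have [act1 actM] := actG.
(* The group may be infinite, so the sum runs over its image in the finite group of permutations of
   [V]. *)
pose H := [set p : {perm V} | `[< exists g, p =1 act g >]].
have act_inj g : injective (act g) by exact: group_action_inj actG.
have HP (p : {perm V}) : reflect (exists g, p =1 act g) (p \in H) by rewrite inE; exact: asboolP.
have H_act g : perm (@act_inj g) \in H by apply/HP; exists g => v; rewrite permE.
have HM p q : p \in H -> q \in H -> (p * q)%g \in H.
  move=> /HP[g pg] /HP[h qh]; apply/HP; exists (h * g)%g => v.
  by rewrite permM pg qh actM.
have HV p : p \in H -> (p^-1)%g \in H.
  move=> /HP[g pg]; apply/HP; exists (g^-1)%g => v.
  by apply: (perm_inj (s := p)); rewrite permKV pg -actM mulgV act1.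
have const u v : \sum_(p in H) w (p u) = \sum_(p in H) w (p v).
  have [g guv] := tr u v; pose q := perm (@act_inj g).
  (* The product [q * p] applies [q] first, so it sends [u] to [p v]. *)
  rewrite (reindex_inj (mulgI q)) /=; apply: eq_big => [p|p _].
    apply/idP/idP => [Hqp|]; last exact: HM (H_act g).
    by rewrite -(mulKg q p) HM ?HV ?H_act.
  by rewrite permM permE guv.
(* Without voters the sum of [w] is empty, so any [a] will do. *)
case: (pickP V) => [u _|V0]; last first.
  exists H, 0; split=> [p /HP //|v|]; first by have := V0 v.
  by rewrite big_pred0 ?eqxx.
exists H, (\sum_(p in H) w (p u)); split=> [p /HP //|v|]; first exact: const.
apply: contra_neq => sum0.
(* Double counting: this sum is also [#|H|] times the total weight, and [H] contains the
   identity. *)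
have : \sum_v \sum_(p in H) w (p v) = 0.
  by rewrite big1 // => v _; rewrite (const v u).
rewrite exchange_big /= (eq_bigr (fun=> \sum_v w v)) => [|p _]; last first.
  by rewrite [RHS](reindex_inj (@perm_inj _ p)).
rewrite sumr_const => /eqP; rewrite mulrn_eq0 cards_eq0 => /orP[/eqP H0|/eqP //].
by have := H_act 1%g; rewrite H0 inE.
Qed.

Lemma borda_score_translate (R : realType) (V : finType) (G : groupType)
    (act : G -> V -> V) (w : V -> R) (g : G) c (e : election V) :
  is_group_action act ->
  borda_score (w \o act g) c e = borda_score w c (induced (act g^-1%g) e).
Proof.
move=> [act1 actM]; rewrite /borda_score [RHS](reindex (act g)) /=.
  by apply: eq_bigr => v _; rewrite ffunE -actM mulVg act1.
by exists (act g^-1%g) => v _; rewrite -actM ?mulVg ?mulgV act1.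
Qed.

(** All ballots have the same sum of ranks, so one that dominates another pointwise is equal to
    it. *)
Lemma ballots_separate (b b' : ballot) :
  b != b' -> exists i j, (b i < b' i)%N /\ (b' j < b j)%N.
Proof.
move=> bb'.
have sumE (c : ballot) : (\sum_i c i = \sum_(i < 3) i)%N.
  by rewrite [RHS](reindex_inj (@perm_inj _ c)).
suff lt (c c' : ballot) : c != c' -> exists i, (c i < c' i)%N.
  by have [i ?] := lt _ _ bb'; rewrite eq_sym in bb'; have [j ?] := lt _ _ bb'; exists i, j.
move=> cc'; case: (pickP (fun i => (c i < c' i)%N)) => [i ?|ge]; first by exists i.
have le i : (c' i <= c i)%N by rewrite leqNgt ge.
have := leqif_sum (P := xpredT) (fun i _ => leqif_eq (le i)).
rewrite !sumE => -[_]; rewrite eqxx => /esym/forallP eqc.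
by case/eqP: cc'; apply/permP => i; apply/val_inj/esym/eqP/eqc.
Qed.

Definition one_dissenter (V : finType) (b b' : ballot) (u : V) : election V :=
  [ffun v => if v == u then b else b'].

Lemma induced_one_dissenter (V : finType) (g : V -> V) (b b' : ballot) u :
  injective g ->
  induced g (one_dissenter b b' (g u)) = one_dissenter b b' u.
Proof. by move=> g_inj; apply/ffunP => v; rewrite !ffunE inj_eq. Qed.

(** The voters other than [u] have total weight [- w u]. *)
Lemma borda_score_one_dissenter (R : realType) (V : finType) (w : V -> R)
    (b b' : ballot) u c :
  \sum_v w v = 0 ->
  borda_score w c (one_dissenter b b' u) = ((b c)%:R - (b' c)%:R) * w u.
Proof.
move=> sum0; rewrite /borda_score (bigD1 u) //= ffunE eqxx.
rewrite (eq_bigr (fun v => (b' c)%:R * w v)) => [|v /negbTE vu]; last first.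
  by rewrite ffunE vu.
have /eqP := sum0; rewrite (bigD1 u) //= addrC addr_eq0 -mulr_sumr => /eqP ->.
by rewrite mulrN mulrBl.
Qed.

(** Nonnegative terms with sum zero all vanish, so some weight is negative; the same argument for
    [- w] gives a positive one. *)
Lemma sum0_opposite_signs (R : realType) (V : finType) (w : V -> R) :
  \sum_v w v = 0 -> (exists v, w v != 0) -> exists u v, w u < 0 < w v.
Proof.
have neg (x : V -> R) : \sum_v x v = 0 -> (exists v, x v != 0) -> exists u, x u < 0.
  move=> sum0 [v xv]; case: (pickP (fun u => x u < 0)) => [u ?|ge0]; first by exists u.
  have x_ge0 u : true -> 0 <= x u by rewrite leNgt ge0.
  have /eqP := sum0; rewrite psumr_eq0 // => /allP/(_ v).
  by rewrite mem_index_enum (negbTE xv) => /(_ isT).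
move=> sum0 [v0 wv0]; have [u wu] := neg w sum0 (ex_intro _ v0 wv0).
have [||v] := neg (fun v => - w v).
- by rewrite sumrN sum0 oppr0.
- by exists v0; rewrite oppr_eq0.
by rewrite oppr_lt0 => wv; exists u, v; rewrite wu wv.
Qed.

Lemma weakly_borda_sum_neq0 (R : realType) (V : finType) (E : {set election V})
    (F : SWF E) (w : V -> R) :
  contains_ballot_domain E -> TA F -> weakly_borda F w -> \sum_v w v != 0.
Proof.
move=> [B /card_gt1P[b [b' [bB b'B bb']]] /subsetP BE].
move=> [G [act [actG tr _ FG]]] /weakly_bordaP[w0 wF].
apply/eqP => sum0; have [u [v /andP[wu wv]]] := sum0_opposite_signs sum0 w0.
have [i [j [bi bj]]] := ballots_separate bb'.
have oneE x : one_dissenter b b' x \in E.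
  by apply: BE; rewrite inE; apply/forallP => y; rewrite ffunE; case: ifP.
pose dissent x : {e : election V | e \in E} := exist (fun e => e \in E) _ (oneE x).
have [g guv] := tr u v.
have Fuv : F (dissent u) = F (dissent v).
  by apply: (FG g); rewrite /= -guv induced_one_dissenter //; exact: group_action_inj actG.
have di : (b i)%:R - (b' i)%:R < 0 :> R by rewrite subr_lt0 ltr_nat.
have dj : 0 < (b j)%:R - (b' j)%:R :> R by rewrite subr_gt0 ltr_nat.
(* Multiplying by the negative [w u] reverses [di < 0 < dj], so [i] beats [j]; the positive [w v]
   keeps the order. *)
have Fij : prefers (F (dissent u)) i j.
  apply: wF; rewrite /= !borda_score_one_dissenter // ltr_nM2r //.
  exact: lt_trans di dj.
have : prefers (F (dissent v)) j i.
  apply: wF; rewrite /= !borda_score_one_dissenter // ltr_pM2r //.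
  exact: lt_trans di dj.
by rewrite -Fuv; apply/negP/prefers_asym.
Qed.

Theorem mainTheorem5 (R : realType) (V : finType) (E : {set election V})
    (F : SWF E) (w : V -> R) :
  contains_ballot_domain E ->
  TA F ->
  weakly_borda F w ->
  exists w' : V -> R, unweighted w' /\ weakly_borda F w'.
Proof.
move=> BE TAF wbF; have sum_neq0 := weakly_borda_sum_neq0 BE TAF wbF.
have [G [act [actG tr GE FG]]] := TAF.
have [H [a [Hact Ha /(_ sum_neq0) a0]]] := transitive_sum_const w actG tr.
have [[v0 _] wF] := (weakly_bordaP F w).1 wbF.
exists (fun=> a); split; first by exists a.
apply/weakly_bordaP; split=> [|e i j]; first by exists v0.
have scoreE c : borda_score (fun=> a) c (val e) =
    \sum_(p in H) borda_score (w \o p) c (val e).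
  rewrite exchange_big; apply: eq_bigr => v _.
  by rewrite -mulr_sumr Ha.
rewrite !scoreE; case: (pickP (fun p => (p \in H) &&
    (borda_score (w \o p) j (val e) < borda_score (w \o p) i (val e)))).
  move=> p /andP[/Hact[g pg]] lt_ji _.
  have pE c : borda_score (w \o p) c (val e) =
      borda_score w c (induced (act g^-1%g) (val e)).
    rewrite -borda_score_translate //.
    by apply: eq_bigr => v _; rewrite /= pg.
  (* Translating the weights by [g] amounts to translating the election by its inverse, which keeps
     it in [E] and leaves the result of [F] unchanged. *)
  pose e' : {e : election V | e \in E} := exist (fun e => e \in E) _ (GE g^-1%g _ (valP e)).
  rewrite -(FG g^-1%g e e' erefl); apply: wF.
  by rewrite /= -!pE.
move=> none; rewrite ltNge ler_sum // => p pH.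
by have := none p; rewrite pH /= leNgt => ->.
Qed.
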